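(* Consider any $q\in\mathbb R^n$ with positive entries such that $\mathrm{diag}(r)^{-1}\mathbf P\,\mathrm{diag}(r)^{-1}\preceq\mathrm{diag}(q)^{-1}$, and consider SAEGA (defined in the context, together with $p,r,\mathbf P$) with stepsize $\alpha=\min_{i,j}\frac{np_iq_j}{4m_i^j+n\sigma}$. Then its iteration complexity is $\max_{i,j}\left(4\frac{m_i^j}{\sigma np_iq_j}+\frac1{p_iq_j}\right)\log\frac1\epsilon$; that is, there exists a matrix $\mathbf B\in\mathbb R^{d\times n}$ with positive entries such that, with $$\Psi^k=\|x^k-x^*\|^2+\alpha\sum_{i=1}^d\sum_{j=1}^n\frac{\mathbf B_{ij}^2}{m_i^j}\left(\mathbf J_{ij}^k-\nabla_if_j(x^* )\right)^2,$$ for every $\epsilon\in(0,1)$ and every integer $k\ge\max_{i,j}\left(4\frac{m_i^j}{\sigma np_iq_j}+\frac1{p_iq_j}\right)\log\frac1\epsilon$ we have $\mathbb E[\Psi^k]\le\epsilon\,\Psi^0$.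
   Context: Problem. $f_1,\dots,f_n:\mathbb R^d\to\mathbb R$ are differentiable and convex, $f=\frac1n\sum_{j=1}^n f_j$, $\psi:\mathbb R^d\to\mathbb R\cup\{+\infty\}$ is proper, closed and convex. $\min_x f(x)+\psi(x)$ has a unique minimizer $x^*$, and $f$ is $\sigma$-quasi strongly convex with $\sigma>0$: $f(x^* )\ge f(y)+\langle\nabla f(y),x^*-y\rangle+\frac\sigma2\|y-x^*\|^2$ for all $y$. Each $f_j$ is $\mathrm{diag}(m^j)$-smooth with $m^j\in\mathbb R^d$ having positive entries $m_1^j,\dots,m_d^j$: $f_j(x)\le f_j(y)+\langle\nabla f_j(y),x-y\rangle+\frac12\sum_im_i^j(x_i-y_i)^2$ for all $x,y$. $\mathrm{prox}_{\alpha\psi}(x)=\arg\min_u\{\alpha\psi(u)+\frac12\|u-x\|^2\}$; $\nabla_i$ denotes the $i$-th partial derivative; $\preceq$ is the Loewner order. Samplings. $L\subseteq[d]$ and $R\subseteq[n]$ are independent random subsets with $p_i=\mathbb P(i\in L)>0$ for all $i$, $r_j=\mathbb P(j\in R)>0$ for all $j$; $p=(p_i)$, $r=(r_j)$; $\mathbf P\in\mathbb R^{n\times n}$ has entries $\mathbf P_{jj'}=\mathbb P(j\in R,\,j'\in R)$. Algorithm (SAEGA). Given $x^0\in\mathbb R^d$, set $\mathbf J^0=0\in\mathbb R^{d\times n}$. For $k=0,1,2,\dots$: draw $L^k$ (copy of $L$) and $R^k$ (copy of $R$), independent of each other and of the past; set $\mathbf J_{ij}^{k+1}=\nabla_if_j(x^k)$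 if $i\in L^k$ and $j\in R^k$, and $\mathbf J_{ij}^{k+1}=\mathbf J_{ij}^k$ otherwise; define $g^k\in\mathbb R^d$ by $g_i^k=\frac1n\sum_{j=1}^n\left(\mathbf J_{ij}^k+\frac1{p_ir_j}(\mathbf J_{ij}^{k+1}-\mathbf J_{ij}^k)\right)$; $x^{k+1}=\mathrm{prox}_{\alpha\psi}(x^k-\alpha g^k)$. *)

(* Defs.v *)
From HB Require Import structures.
From mathcomp Require Import all_boot all_order all_algebra.
From mathcomp Require Import all_classical all_reals all_analysis.
Set Implicit Arguments.
Unset Strict Implicit.
Unset Printing Implicit Defensive.
Import Order.TTheory GRing.Theory Num.Theory numFieldNormedType.Exports.
Local Open Scope classical_set_scope.
Local Open Scope ring_scope.

Section Euclidean.
Context {R : realType} {d : nat}.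
Implicit Types (x y u v : 'rV[R]_d) (f : 'rV[R]_d -> R).

Definition dot u v : R := \sum_i u 0 i * v 0 i.

(* The library norm on 'rV[R]_d is the sup norm, so the Euclidean one is
   defined through the inner product. *)
Definition sqnorm u : R := dot u u.

Definition partial f (i : 'I_d) x : R := 'D_(delta_mx 0 i) f x.

Definition grad f x : 'rV[R]_d := \row_i partial f i x.

Definition diag_smooth (m : 'rV[R]_d) f : Prop := forall x y,
  f x <= f y + dot (grad f y) (x - y)
         + 2^-1 * \sum_i m 0 i * (x 0 i - y 0 i) ^+ 2.

Definition quasi_strongly_convex (sigma : R) f (xs : 'rV[R]_d) : Prop :=
  forall y, f xs >= f y + dot (grad f y) (xs - y)
                    + sigma / 2 * sqnorm (y - xs).

End Euclidean.

Section ExtendedRealFunctions.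
Context {R : realType} {d : nat}.
Implicit Types (x y u : 'rV[R]_d) (psi h : 'rV[R]_d -> \bar R).
Local Open Scope ereal_scope.

Definition proper_efun psi : Prop :=
  (forall x, psi x != -oo) /\ (exists x, psi x < +oo).

Definition closed_efun psi : Prop :=
  closed [set xt : 'rV[R]_d * R | psi xt.1 <= xt.2%:E].

(* At t = 0 and t = 1 the convention 0 * +oo = 0 makes this trivially true. *)
Definition convex_efun psi : Prop := forall x y (t : R),
  (0 <= t <= 1)%R ->
  psi (t *: x + (1 - t) *: y)%R <= t%:E * psi x + (1 - t)%:E * psi y.

Definition argmin h : set 'rV[R]_d := [set x | forall y, h x <= h y].

Definition unique_minimizer h x : Prop := argmin h = [set x].

(* The junk value 0 is only used when the argmin is empty, which cannot happen
   for psi proper, closed, convex and alpha > 0. *)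
Definition prox (alpha : R) psi x : 'rV[R]_d :=
  xget 0%R (argmin (fun u => alpha%:E * psi u + (2^-1 * sqnorm (u - x))%:E)).

End ExtendedRealFunctions.

Section Matrices.
Context {R : realType}.

Definition loewner_le {n} (A B : 'M[R]_n) : Prop :=
  forall v : 'cV[R]_n, 0 <= (v^T *m (B - A) *m v) 0 0.

(* Minimum and maximum over all index pairs; the index sets are nonempty, and
   the (0, 0) entry serves as the starting value of the fold. *)
Definition min_ij {d n} (F : 'I_d.+1 -> 'I_n.+1 -> R) : R :=
  \big[Num.min/F ord0 ord0]_(ij : 'I_d.+1 * 'I_n.+1) F ij.1 ij.2.

Definition max_ij {d n} (F : 'I_d.+1 -> 'I_n.+1 -> R) : R :=
  \big[Num.max/F ord0 ord0]_(ij : 'I_d.+1 * 'I_n.+1) F ij.1 ij.2.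

End Matrices.

Section RandomElements.
Context {disp : measure_display} {T : measurableType disp} {R : realType}.
Variable P : probability T R.

Definition random_element {F : finType} (X : T -> F) : Prop :=
  forall A : set F, measurable (X @^-1` A).

Definition same_law {F : finType} (X Y : T -> F) : Prop :=
  forall A : set F, P (X @^-1` A) = P (Y @^-1` A).

Definition independent {F G : finType} (X : T -> F) (Y : T -> G) : Prop :=
  forall (A : set F) (B : set G),
    P (X @^-1` A `&` Y @^-1` B) = (P (X @^-1` A) * P (Y @^-1` B))%E.

Definition mutually_independent {F : finType} (X : nat -> T -> F) : Prop :=
  forall (s : seq nat) (A : nat -> set F), uniq s ->
    P (\big[setI/setT]_(k <- s) (X k @^-1` A k))
    = (\prod_(k <- s) P (X k @^-1` A k))%E.

Definition incl_prob {n} (S : T -> {set 'I_n}) : 'rV[R]_n :=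
  \row_i fine (P [set w | i \in S w]).

Definition incl_mx {n} (S : T -> {set 'I_n}) : 'M[R]_n :=
  \matrix_(i, j) fine (P [set w | i \in S w /\ j \in S w]).

End RandomElements.

Section SAEGA.
Context {R : realType} {d n : nat}.
Variable f : 'I_n -> 'rV[R]_d -> R.

Definition avg (x : 'rV[R]_d) : R := n%:R^-1 * \sum_j f j x.

Definition saega_jac (x : 'rV[R]_d) (J : 'M[R]_(d, n))
    (A : {set 'I_d}) (S : {set 'I_n}) : 'M[R]_(d, n) :=
  \matrix_(i, j) if (i \in A) && (j \in S) then partial (f j) i x else J i j.

Definition saega_est (p : 'rV[R]_d) (r : 'rV[R]_n) (J J' : 'M[R]_(d, n))
    : 'rV[R]_d :=
  \row_i (n%:R^-1 * \sum_j (J i j + (p 0 i * r 0 j)^-1 * (J' i j - J i j))).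

Fixpoint saega (psi : 'rV[R]_d -> \bar R) (alpha : R)
    (p : 'rV[R]_d) (r : 'rV[R]_n) (x0 : 'rV[R]_d)
    (Lk : nat -> {set 'I_d}) (Rk : nat -> {set 'I_n}) (k : nat)
    : 'rV[R]_d * 'M[R]_(d, n) :=
  if k is k'.+1 then
    let: (x, J) := saega psi alpha p r x0 Lk Rk k' in
    let J' := saega_jac x J (Lk k') (Rk k') in
    (prox alpha psi (x - alpha *: saega_est p r J J'), J')
  else (x0, 0).

Definition lyapunov (m : 'I_n -> 'rV[R]_d) (xs : 'rV[R]_d) (alpha : R)
    (B : 'M[R]_(d, n)) (xJ : 'rV[R]_d * 'M[R]_(d, n)) : R :=
  sqnorm (xJ.1 - xs)
  + alpha * \sum_i \sum_j
      B i j ^+ 2 / m j 0 i * (xJ.2 i j - partial (f j) i xs) ^+ 2.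

End SAEGA.

(* Main.v *)
(* One step of SAEGA contracts the Lyapunov function in conditional expectation
   by the factor [1 - alpha sigma], and [1 / (alpha sigma)] is the complexity of
   the statement. The entries of the matrix are [B_ij ^ 2 = 1 / (2 n p_i r_j)].
   Write [a = grad f_j (x) - grad f_j (xs)] and [b = J - grad f_j (xs)]
   entrywise. Then [g - grad f (xs)] is a block-sampled average of [a] plus a
   centred block-sampled average of [b]; the matrix inequality on [P] bounds the
   second moment of each by [sum_ij (.)^2 / (n^2 p_i q_j)]. The terms in [a] are
   paid for by co-coercivity of the convex smooth [f_j] and the terms in [b] by
   the decrease of the stored errors, using [q_j <= r_j]. *)

Require Import Defs.
From HB Require Import structures.
From mathcomp Require Import all_boot all_order all_algebra.
From mathcomp Require Import ring lra.
From mathcomp Require Import all_classical all_reals all_analysis.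
From mathcomp Require Import measurable_realfun.
Set Implicit Arguments.
Unset Strict Implicit.
Unset Printing Implicit Defensive.
Import Order.TTheory GRing.Theory Num.Theory numFieldNormedType.Exports.
Local Open Scope classical_set_scope.
Local Open Scope ring_scope.

(** * Euclidean inner product and squared norm *)

Section InnerProduct.
Context {R : realType} {d : nat}.
Implicit Types (u v w : 'rV[R]_d) (a : R).

Lemma dotC u v : dot u v = dot v u.
Proof. by apply: eq_bigr => i _; rewrite mulrC. Qed.

Lemma dotDr u v w : dot u (v + w) = dot u v + dot u w.
Proof. by rewrite -big_split; apply: eq_bigr => i _; rewrite mxE mulrDr. Qed.

Lemma dotZr u a v : dot u (a *: v) = a * dot u v.
Proof. by rewrite mulr_sumr; apply: eq_bigr => i _; rewrite mxE mulrCA. Qed.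

Lemma dotNr u v : dot u (- v) = - dot u v.
Proof. by rewrite -scaleN1r dotZr mulN1r. Qed.

Lemma dotBr u v w : dot u (v - w) = dot u v - dot u w.
Proof. by rewrite dotDr dotNr. Qed.

Lemma sqnorm_ge0 u : 0 <= sqnorm u.
Proof. by apply: sumr_ge0 => i _; rewrite -expr2 sqr_ge0. Qed.

Lemma sqnormZ a u : sqnorm (a *: u) = a ^+ 2 * sqnorm u.
Proof. by rewrite /sqnorm dotZr dotC dotZr; ring. Qed.

Lemma sqnormD u v : sqnorm (u + v) = sqnorm u + 2 * dot u v + sqnorm v.
Proof. by rewrite /sqnorm dotDr !(dotC (u + v)) !dotDr (dotC v u); ring. Qed.

Lemma sqnormN u : sqnorm (- u) = sqnorm u.
Proof. by rewrite -scaleN1r sqnormZ; ring. Qed.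

Lemma sqnormB u v : sqnorm (u - v) = sqnorm u - 2 * dot u v + sqnorm v.
Proof. by rewrite sqnormD dotNr sqnormN; ring. Qed.

Lemma sqr_coord_le u i : u 0 i ^+ 2 <= sqnorm u.
Proof.
rewrite /sqnorm /dot (bigD1 i)//= expr2 lerDl.
by apply: sumr_ge0 => j _; rewrite -expr2 sqr_ge0.
Qed.

End InnerProduct.

(** Stands in for the limit [t -> 0] in first-order arguments. If [a > 0], then [t = 1] gives
    [a <= c], so [t = a / (2 c)] is admissible and yields [a <= a / 2]. *)
Lemma le_small_multiple_le0 (R : realFieldType) (a c : R) :
  (forall t, 0 < t <= 1 -> a <= t * c) -> a <= 0.
Proof.
move=> h; case: (lerP a 0) => // a0.
have ac : a <= c by have := h 1; rewrite mul1r; apply; lra.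
have c0 : 0 < c by lra.
have := h (a / (2 * c)); rewrite divr_gt0 ?mulr_gt0// ler_pdivrMr ?mulr_gt0//.
have -> : a / (2 * c) * c = a / 2 by field; lra.
by move=> /(_ ltac:(lra)); lra.
Qed.

(** * Convex functions with a diagonal quadratic upper bound *)

Section SmoothConvex.
Context {R : realType} {d : nat}.
Implicit Types (f phi : 'rV[R]_d -> R) (m : 'rV[R]_d) (x y h u v : 'rV[R]_d).

Definition quad m h : R := 2^-1 * \sum_i m 0 i * h 0 i ^+ 2.

Lemma quadZ m (t : R) h : quad m (t *: h) = t ^+ 2 * quad m h.
Proof.
rewrite /quad mulrCA; congr (_ * _); rewrite mulr_sumr.
by apply: eq_bigr => i _; rewrite mxE; ring.
Qed.

Lemma diag_smooth_line m f y h (t : R) : diag_smooth m f ->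
  f (y + t *: h) <= f y + t * dot (grad f y) h + t ^+ 2 * quad m h.
Proof.
move=> /(_ (y + t *: h) y).
have -> : y + t *: h - y = t *: h by rewrite addrC addKr.
rewrite dotZr -quadZ /quad; congr (_ <= _ + _ * _).
by apply: eq_bigr => i _; rewrite !mxE addrAC subrr add0r.
Qed.

Lemma convex_functionE f (t : R) x y :
  convex_function [set: 'rV[R]_d] f -> 0 <= t <= 1 ->
  f (t *: x + (1 - t) *: y) <= t * f x + (1 - t) * f y.
Proof.
move=> cf /andP[t0 t1].
have Ht : Itv.spec (@Itv.num_sem R) (Itv.Real `[0%Z, 1%Z]) t.
  by rewrite /Itv.num_sem/= in_itv/= t0 t1 ger0_real.
by have := cf (@Itv.Def R _ _ t Ht) x y; rewrite !inE; apply.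
Qed.

(* [y] is a convex combination of [y + h] and [y - t h]; bounding [f (y - t h)]
   by smoothness and letting [t] tend to [0] gives the gradient inequality
   without differentiating along lines. *)
Lemma convex_gradient_ineq m f y h :
  convex_function [set: 'rV[R]_d] f -> diag_smooth m f ->
  f y + dot (grad f y) h <= f (y + h).
Proof.
move=> cf sf.
suff : f y + dot (grad f y) h - f (y + h) <= 0 by lra.
apply: (@le_small_multiple_le0 _ _ (quad m h)) => t /andP[t0 t1].
have s0 : 0 < 1 + t by lra.
have /(convex_functionE (y + h) (y - t *: h) cf) : 0 <= t / (1 + t) <= 1.
  by rewrite divr_ge0 ?ler_pdivrMr//=; lra.
have -> : (t / (1 + t)) *: (y + h) + (1 - t / (1 + t)) *: (y - t *: h) = y.
  by apply/rowP => i; rewrite !mxE; field; lra.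
have -> : 1 - t / (1 + t) = (1 + t)^-1 by field; lra.
have -> : t / (1 + t) * f (y + h) + (1 + t)^-1 * f (y - t *: h)
        = (t * f (y + h) + f (y - t *: h)) / (1 + t) by field; lra.
rewrite ler_pdivlMr// -scaleNr => H1.
have := diag_smooth_line y h (- t) sf; rewrite sqrrN => H2.
by rewrite -(ler_pM2l t0); lra.
Qed.

(** The step [h] from [x] minimizes the quadratic upper model of [f - dot (grad f y)]. The gradient
    inequality at [y] bounds that function from below at [x + h], and the model decreases by half of
    the weighted sum. *)
Lemma cocoercive m f x y :
  convex_function [set: 'rV[R]_d] f -> diag_smooth m f ->
  (forall i, 0 < m 0 i) ->
  2^-1 * \sum_i (partial f i x - partial f i y) ^+ 2 / m 0 i
    <= f x - f y - dot (grad f y) (x - y).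
Proof.
move=> cf sf m0.
set S := \sum_i _.
pose h : 'rV[R]_d := \row_i (- ((partial f i x - partial f i y) / m 0 i)).
have H1 : f y + dot (grad f y) (x - y + h) <= f (x + h).
  have := convex_gradient_ineq y (x - y + h) cf sf.
  by rewrite addrA [y + _]addrC subrK.
have := diag_smooth_line x h 1 sf; rewrite scale1r expr1n !mul1r => H2.
have qh : quad m h = 2^-1 * S.
  congr (_ * _); apply: eq_bigr => i _; rewrite mxE; field.
  by rewrite gt_eqF.
have dh : dot (grad f x) h - dot (grad f y) h = - S.
  rewrite -sumrB -sumrN; apply: eq_bigr => i _; rewrite !mxE; ring.
by move: H1; rewrite dotDr => H1; lra.
Qed.

End SmoothConvex.

(** * First-order optimality for a smooth plus a convex function *)

Section CompositeMinimizer.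
Context {R : realType} {d : nat}.
Implicit Types (phi : 'rV[R]_d -> R) (psi : 'rV[R]_d -> \bar R).
Implicit Types (u v x y z g : 'rV[R]_d).

(** Compares [u] with [u + t (v - u)], where [a] bounds the slope of [phi] towards [v]. Convexity of
    [psi] leaves an error [t ^ 2 C], which vanishes after division by [t]. It serves both for the
    prox objective and for [f + psi]. *)
Lemma argmin_variational psi phi (alpha a C b c : R) u v :
  convex_efun psi -> 0 < alpha ->
  argmin (fun x => alpha%:E * psi x + (phi x)%:E)%E u ->
  (forall t, 0 < t <= 1 ->
    phi (u + t *: (v - u)) <= phi u + t * a + t ^+ 2 * C) ->
  psi u = b%:E -> psi v = c%:E -> alpha * b <= alpha * c + a.
Proof.
move=> cpsi a0 umin qphi pu pv.
suff : alpha * b - alpha * c - a <= 0 by lra.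
apply: (@le_small_multiple_le0 _ _ C) => t /andP[t0 t1].
have := cpsi v u t; rewrite (ltW t0) t1 => /(_ isT).
have -> : t *: v + (1 - t) *: u = u + t *: (v - u).
  by apply/rowP => i; rewrite !mxE; ring.
rewrite pu pv -!EFinM -EFinD => H1.
have := umin (u + t *: (v - u)); rewrite pu => H2.
have : (alpha * b + phi u <= alpha * (t * c + (1 - t) * b)
          + phi (u + t *: (v - u)))%R.
  rewrite -lee_fin !EFinD !EFinM; apply: (le_trans H2).
  by rewrite leeD2r// lee_pmul2l ?fin_numE// lte_fin.
have := qphi t; rewrite t0 t1 => /(_ isT) H3 H4.
by rewrite -(ler_pM2l t0); lra.
Qed.

End CompositeMinimizer.

(** * Existence of the prox and its contraction towards the minimizer *)

Section Prox.
Context {R : realType} {d : nat}.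
Implicit Types (psi : 'rV[R]_d -> \bar R) (u v x z g : 'rV[R]_d).

(* The objective is minimized over the part of the epigraph of [psi] that lies
   in a compact box; the affine minorant confines a sublevel set to the box. *)
Lemma prox_argmin psi (alpha c : R) g z :
  0 < alpha -> proper_efun psi -> closed_efun psi ->
  (forall v, ((c + dot g v)%:E <= psi v)%E) ->
  argmin (fun u => alpha%:E * psi u + (2^-1 * sqnorm (u - z))%:E)%E
    (prox alpha psi z).
Proof.
move=> a0 [psiNy [v0 psi0]] cpsi lb.
suff [u umin] : exists u, argmin
    (fun u => alpha%:E * psi u + (2^-1 * sqnorm (u - z))%:E)%E u.
  exact: (xgetPex 0 (ex_intro _ u umin)).
have [c0 pc0] : exists c0, psi v0 = c0%:E.
  by move: psi0 (psiNy v0); case: (psi v0) => // r _ _; exists r.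
(* With [psi] replaced by a height the objective is continuous; the closed epigraph carries the
   lower semicontinuity of [psi]. *)
pose F (xt : 'rV[R]_d * R) := alpha * xt.2 + 2^-1 * sqnorm (xt.1 - z).
pose M := F (v0, c0).
(* The square of [2^-1 *: (v - z) + alpha *: g] absorbs the linear term of the minorant into half of
   the quadratic, so that [F (v, t) <= M] forces [sqnorm (v - z) <= K] and then [lo <= t]. *)
pose K := 4 * (M - alpha * c - alpha * dot g z + alpha ^+ 2 * sqnorm g).
pose lo := c + dot g z - alpha^-1 * (4^-1 * K + alpha ^+ 2 * sqnorm g).
pose box : set ('rV[R]_d * R) :=
  [set v : 'rV[R]_d |
     forall i, `[(z 0 i - (K + 1)), (z 0 i + (K + 1))]%classic (v ord0 i)]
    `*` `[lo, M / alpha]%classic.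
pose epi : set ('rV[R]_d * R) := [set xt | psi xt.1 <= xt.2%:E]%E.
have sub v t : epi (v, t) -> F (v, t) <= M -> box (v, t).
  move=> /= psit; rewrite /F/= => FM.
  have tlb : c + dot g v <= t by rewrite -lee_fin (le_trans (lb v)).
  have gv : dot g v = dot g (v - z) + dot g z by rewrite dotBr subrK.
  have sq := sqnorm_ge0 (2^-1 *: (v - z) + alpha *: g).
  rewrite sqnormD !sqnormZ dotC !dotZr dotC dotZr in sq.
  rewrite dotC in sq.
  have ta : alpha * (c + dot g v) <= alpha * t by rewrite ler_pM2l.
  have sqK : sqnorm (v - z) <= K by rewrite /K; rewrite gv in ta; lra.
  split=> /=.
    move=> i; rewrite /= in_itv/=.
    have := le_trans (sqr_coord_le (v - z) i) sqK; rewrite !mxE => viK.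
    (* The bound [s <= s ^ 2 + 1/4] gives the radius [K + 1] without a square root. *)
    have : `|v 0 i - z 0 i| <= K + 1.
      have := sqr_ge0 (`|v 0 i - z 0 i| - 2^-1).
      rewrite -real_normK ?num_real// in viK.
      by have := normr_ge0 (v 0 i - z 0 i); nra.
    by rewrite ler_norml; lra.
  rewrite in_itv/= ler_pdivlMr// -(ler_pM2l a0) /lo mulrBr mulrA mulfV ?gt_eqF//.
  have := sqnorm_ge0 (v - z); rewrite gv in ta; lra.
have cbox : compact box.
  apply: compact_setX; last exact: segment_compact.
  apply: (@rV_compact R d
    (fun i => `[(z 0 i - (K + 1)), (z 0 i + (K + 1))]%classic)) => i.
  exact: segment_compact.
have cS : compact (box `&` epi) by apply: compact_closedI.
have S0 : box `&` epi !=set0.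
  by exists (v0, c0); split; [apply: sub|]; rewrite /epi/= ?pc0//.
have cF : continuous F.
  move=> xt; apply: cvgD; apply: cvgM;
    [exact: cvg_cst|exact: cvg_snd|exact: cvg_cst|].
  apply: cvg_big => [|i _]; first exact: add_continuous.
  have ci :
      (fun xt : 'rV[R]_d * R => (xt.1 - z) 0 i) x @[x --> xt] --> (xt.1 - z) 0 i.
    under eq_fun do rewrite !mxE; rewrite !mxE.
    apply: cvgB; last exact: cvg_cst.
    apply: (@cvg_comp _ _ _ fst (fun v : 'rV[R]_d => v 0 i)); first exact: cvg_fst.
    exact: coord_continuous.
  exact: cvgM.
have [[u t]] := compact_EVT_min S0 cS (continuous_subspaceT cF).
rewrite inE => -[_ /= ut] umin.
exists u => v.
have /le_trans : (alpha%:E * psi u + (2^-1 * sqnorm (u - z))%:E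
   <= (F (u, t))%:E)%E.
  by rewrite /F EFinD (EFinM alpha) leeD2r// lee_pmul2l ?fin_numE// lte_fin.
apply.
case psiv: (psi v) => [s||]; first last.
- by have := psiNy v; rewrite psiv.
- by rewrite gt0_muley ?lte_fin// addye// leey.
rewrite -EFinM -EFinD lee_fin.
(* Outside the sublevel set the value exceeds [M = F (v0, c0)], which is itself at least the
   minimum. *)
have [FM|FM] := leP (F (v, s)) M.
  by apply: (umin (v, s)); rewrite inE; split; [apply: sub|]; rewrite /epi/= ?psiv.
apply: ltW; apply: le_lt_trans FM.
by apply: umin; rewrite inE; split; [apply: sub|]; rewrite /epi/= ?pc0.
Qed.

(* Only the variational inequalities at [prox alpha psi z] and at [xs] are
   compared, so [xs] need not be exhibited as a prox. *)
Lemma prox_contraction psi (alpha b : R) xs z g :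
  0 < alpha -> proper_efun psi -> closed_efun psi -> convex_efun psi ->
  psi xs = b%:E -> (forall v, ((b - dot g (v - xs))%:E <= psi v)%E) ->
  sqnorm (prox alpha psi z - xs) <= sqnorm (z + alpha *: g - xs).
Proof.
move=> a0 ppsi cpsi vpsi pxs sub.
have umin : argmin (fun u => alpha%:E * psi u + (2^-1 * sqnorm (u - z))%:E)%E
    (prox alpha psi z).
  apply: (@prox_argmin _ _ (b + dot g xs) (- g)) => // v.
  apply: le_trans (sub v); rewrite lee_fin (dotC (- g)) dotNr (dotC v) dotBr.
  by lra.
set u := prox _ _ _ in umin *.
have [c pu] : exists c, psi u = c%:E.
  have := umin xs; rewrite pxs; move: (ppsi.1 u).
  case: (psi u) => [c||] // _; first by exists c.
  by rewrite gt0_muley ?lte_fin// addye// leye_eq -EFinM -EFinD.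
have H1 : alpha * c <= alpha * b + dot (u - z) (xs - u).
  apply: (argmin_variational (C := 2^-1 * sqnorm (xs - u))) umin _ pu pxs => //.
  move=> t _; rewrite (addrAC u) (sqnormD (u - z)) dotZr sqnormZ; lra.
have := sub u; rewrite pu lee_fin => H2.
have H3 : alpha * (b - dot g (u - xs)) <= alpha * c by rewrite ler_pM2l.
(* The two variational inequalities add up to [sqnorm y <= dot e y], and [0 <= sqnorm (e - y)] turns
   this into [sqnorm y <= sqnorm e]. *)
set e := z + _ - _; set y := u - xs.
have H4 : dot (u - z) (xs - u) = dot (e - alpha *: g - y) y.
  have -> : xs - u = - y by rewrite opprB.
  have -> : u - z = - (e - alpha *: g - y).
    by apply/rowP => i; rewrite !mxE; ring.
  by rewrite dotNr dotC dotNr opprK dotC.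
have := sqnorm_ge0 (e - y); rewrite sqnormB => H5.
have H6 (a y' : 'rV[R]_d) :
    dot (a - alpha *: g - y') y' = dot a y' - alpha * dot g y' - sqnorm y'.
  by rewrite dotC !dotBr dotZr (dotC y' a) (dotC y' g).
by move: H1 H3; rewrite H4 H6 -/y => H1 H3; lra.
Qed.

End Prox.

(** * Weighted means over a finite type *)

Section FiniteMean.
Context {R : realType} {F : finType} (mu : F -> R).
Implicit Types X Y : F -> R.

Definition mean X : R := \sum_a mu a * X a.

Lemma eq_mean X Y : X =1 Y -> mean X = mean Y.
Proof. by move=> XY; apply: eq_bigr => a _; rewrite XY. Qed.

Lemma meanD X Y : mean (fun a => X a + Y a) = mean X + mean Y.
Proof. by rewrite -big_split; apply: eq_bigr => a _; rewrite mulrDr. Qed.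

Lemma meanZ (c : R) X : mean (fun a => c * X a) = c * mean X.
Proof. by rewrite mulr_sumr; apply: eq_bigr => a _; rewrite mulrCA. Qed.

Lemma mean_sum (I : finType) (X : I -> F -> R) :
  mean (fun a => \sum_i X i a) = \sum_i mean (X i).
Proof. by rewrite exchange_big; apply: eq_bigr => a _; rewrite mulr_sumr. Qed.

Lemma mean_cst (c : R) : mean (fun=> 1) = 1 -> mean (fun=> c) = c.
Proof.
move=> m1; rewrite -[RHS]mulr1 -m1 -meanZ.
by apply: eq_mean => a; rewrite mulr1.
Qed.

Lemma ler_mean X Y : (forall a, 0 <= mu a) -> (forall a, X a <= Y a) ->
  mean X <= mean Y.
Proof. by move=> mu0 XY; apply: ler_sum => a _; rewrite ler_wpM2l. Qed.

End FiniteMean.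

(** * Moments of block-sampled averages *)

Section RandomBlock.
Context {R : realType} {d n : nat} (mu : {set 'I_d} * {set 'I_n} -> R).
Context (p : 'rV[R]_d) (r q : 'rV[R]_n) (PP : 'M[R]_n).

Definition block (i : 'I_d) (j : 'I_n) (a : {set 'I_d} * {set 'I_n}) : R :=
  ((i \in a.1) && (j \in a.2))%:R.

(* The independence of the two samplings enters through [pair] and [triple];
   [eso] is the expected separable overapproximation of the sampling of
   components. *)
Record block_law : Prop := BlockLaw {
  law_ge0 : forall a, 0 <= mu a;
  law_sum1 : mean mu (fun=> 1) = 1;
  law_pair : forall i j, mean mu (block i j) = p 0 i * r 0 j;
  law_triple : forall i j j',
    mean mu (fun a => block i j a * block i j' a) = p 0 i * PP j j';
  law_p_gt0 : forall i, 0 < p 0 i;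
  law_r_gt0 : forall j, 0 < r 0 j;
  law_eso : forall v : 'I_n -> R,
    \sum_j \sum_j' v j * v j' * PP j j' / (r 0 j * r 0 j')
      <= \sum_j v j ^+ 2 / q 0 j }.

Context (law : block_law).

(** Importance-weighted estimate, in coordinate [i], of the average of [v] from the sampled
    entries. *)
Definition block_avg i (v : 'I_n -> R) a : R :=
  n%:R^-1 * \sum_j (p 0 i * r 0 j)^-1 * block i j a * v j.

Lemma mean_block_avg i v : mean mu (block_avg i v) = n%:R^-1 * \sum_j v j.
Proof.
rewrite meanZ mean_sum; congr (_ * _); apply: eq_bigr => j _.
under eq_mean do rewrite mulrC mulrA.
rewrite meanZ law_pair//; field.
by rewrite !gt_eqF// ?(law_p_gt0 law)// (law_r_gt0 law).
Qed.

(** Expanding the square, the moments [p_i PP_jj'] cancel one of the two factors [1 / p_i] and leave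
    the quadratic form that [law_eso] bounds. *)
Lemma mean_block_avg_sqr i v :
  mean mu (fun a => block_avg i v a ^+ 2)
    <= n%:R^-1 ^+ 2 * (p 0 i)^-1 * \sum_j v j ^+ 2 / q 0 j.
Proof.
have p0 := law_p_gt0 law; have r0 := law_r_gt0 law.
have -> : mean mu (fun a => block_avg i v a ^+ 2) = n%:R^-1 ^+ 2 * (p 0 i)^-1 *
    \sum_j \sum_j' v j * v j' * PP j j' / (r 0 j * r 0 j').
  under eq_mean => a.
    rewrite exprMn [X in _ * X]expr2 mulr_suml.
    under eq_bigr do rewrite mulr_sumr.
    over.
  rewrite meanZ mean_sum -mulrA; congr (_ * _); rewrite mulr_sumr.
  apply: eq_bigr => j _; rewrite mean_sum mulr_sumr; apply: eq_bigr => j' _.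
  rewrite (eq_mean _ (Y := fun a => (p 0 i * r 0 j)^-1 * v j *
      (p 0 i * r 0 j')^-1 * v j' * (block i j a * block i j' a))); last first.
    by move=> a; ring.
  by rewrite meanZ law_triple//; field; rewrite !gt_eqF.
by rewrite ler_wpM2l ?law_eso// mulr_ge0 ?sqr_ge0// invr_ge0 ltW.
Qed.

(** The estimate is unbiased, so this is its variance, at most its second moment. *)
Lemma mean_block_avg_var i v :
  mean mu (fun a => (n%:R^-1 * (\sum_j v j) - block_avg i v a) ^+ 2)
    <= mean mu (fun a => block_avg i v a ^+ 2).
Proof.
set c := _ * \sum_j v j.
rewrite (eq_mean _ (Y := fun a => c ^+ 2 +
   (- (2 * c) * block_avg i v a + block_avg i v a ^+ 2))); last by move=> a; ring.
have Eb : mean mu (fun a => block_avg i v a) = c by exact: mean_block_avg.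
rewrite !meanD (meanZ _ (- (2 * c))) Eb mean_cst ?law_sum1//.
by have := sqr_ge0 c; lra.
Qed.

(** By [(a + b)^2 <= 2 a^2 + 2 b^2]. This factor 2, doubled by the choice of [lyapunov_weight], is
    the origin of the 4 in the stepsize. *)
Lemma mean_block_avg_mix i (u v : 'I_n -> R) :
  mean mu (fun a => (block_avg i u a
                     + (n%:R^-1 * (\sum_j v j) - block_avg i v a)) ^+ 2)
    <= 2 * (n%:R^-1 ^+ 2 * (p 0 i)^-1 *
         \sum_j (u j ^+ 2 / q 0 j + v j ^+ 2 / q 0 j)).
Proof.
set c := _ * \sum_j v j.
apply: (@le_trans _ _ (mean mu (fun a => 2 * (block_avg i u a ^+ 2) +
   2 * (c - block_avg i v a) ^+ 2))).
  apply: ler_mean => [a|a]; first exact: law_ge0.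
  by have := sqr_ge0 (block_avg i u a - (c - block_avg i v a)); lra.
rewrite meanD !meanZ big_split/=.
have := mean_block_avg_sqr i u; have := mean_block_avg_sqr i v.
by have := mean_block_avg_var i v; rewrite -/c; lra.
Qed.

Lemma mean_block_update i j (x y : R) :
  mean mu (fun a => (if (i \in a.1) && (j \in a.2) then x else y) ^+ 2)
    = (1 - p 0 i * r 0 j) * y ^+ 2 + p 0 i * r 0 j * x ^+ 2.
Proof.
rewrite (eq_mean _ (Y := fun a => y ^+ 2 + (x ^+ 2 - y ^+ 2) * block i j a)).
  rewrite meanD (meanZ _ (x ^+ 2 - y ^+ 2)) law_pair// mean_cst ?law_sum1//.
  by ring.
by move=> a; rewrite /block; case: (_ && _) => /=; ring.
Qed.

(** On the [j]-th unit vector [law_eso] reads [PP_jj / r_j^2 <= 1 / q_j]. The coordinate [i] serves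
    to derive [PP_jj = r_j], an indicator being its own square. *)
Lemma eso_le_prob (i : 'I_d) j : (forall j, 0 < q 0 j) -> q 0 j <= r 0 j.
Proof.
move=> q0.
have p0 := law_p_gt0 law; have r0 := law_r_gt0 law.
have Pjj : PP j j = r 0 j.
  apply: (mulfI (negbT (gt_eqF (p0 i)))).
  rewrite -law_triple// -law_pair//; apply: eq_mean => a.
  by rewrite /block; case: (_ && _) => /=; ring.
have single (G : 'I_n -> R) : (forall k, k != j -> G k = 0) -> \sum_k G k = G j.
  by move=> G0; rewrite (bigD1 j)//= big1 ?addr0.
have := law_eso law (fun k => (k == j)%:R).
rewrite [leLHS]single => [|k /negPf kj]; last first.
  by rewrite big1// => k' _; rewrite kj /=; ring.
rewrite [leLHS]single => [|k /negPf kj]; last by rewrite kj /=; ring.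
rewrite [leRHS]single => [|k /negPf kj]; last by rewrite kj /=; ring.
rewrite eqxx Pjj expr1n !mul1r.
rewrite invfM mulrA mulfV ?gt_eqF// mul1r.
by rewrite lef_pV2// posrE.
Qed.

End RandomBlock.

(** * Co-coercivity and quasi strong convexity of the average *)

Section Descent.
Context {R : realType} {d n : nat} (f : 'I_n -> 'rV[R]_d -> R).
Context (m : 'I_n -> 'rV[R]_d) (xs : 'rV[R]_d) (sigma : R).
Implicit Types (x v : 'rV[R]_d).

Lemma partial_avg i x : (forall j x, differentiable (f j) x) ->
  partial (avg f) i x = n%:R^-1 * \sum_j partial (f j) i x.
Proof.
move=> df.
have dv j : derivable (f j) x (delta_mx 0 i) by exact: diff_derivable.
rewrite /partial; have -> : avg f = n%:R^-1 \*: (\sum_j f j).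
  by apply/funext => y; rewrite /avg /= fct_sumE.
by rewrite deriveZ ?derive_sum//; exact: derivable_sum.
Qed.

Lemma dot_grad_avg x v : (forall j x, differentiable (f j) x) ->
  dot (grad (avg f) x) v = n%:R^-1 * \sum_j dot (grad (f j) x) v.
Proof.
move=> df; rewrite exchange_big mulr_sumr; apply: eq_bigr => i _.
rewrite mxE partial_avg// -mulrA mulr_suml; congr (_ * _).
by apply: eq_bigr => j _; rewrite mxE.
Qed.

(** Twice the sum of the averaged co-coercivity inequality between [x] and [xs] and of quasi strong
    convexity at [x]; the function values cancel. *)
Lemma descent_ineq x :
  (forall j x, differentiable (f j) x) ->
  (forall j, convex_function [set: 'rV[R]_d] (f j)) ->
  (forall j, diag_smooth (m j) (f j)) ->
  (forall j i, 0 < m j 0 i) ->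
  quasi_strongly_convex sigma (avg f) xs ->
  n%:R^-1 * (\sum_i \sum_j
     (partial (f j) i x - partial (f j) i xs) ^+ 2 / m j 0 i)
  + sigma * sqnorm (x - xs)
    <= 2 * dot (x - xs) (grad (avg f) x - grad (avg f) xs).
Proof.
move=> df cf sf m0 /(_ x) qsc.
have coco : n%:R^-1 * (\sum_j 2^-1 * \sum_i
    (partial (f j) i x - partial (f j) i xs) ^+ 2 / m j 0 i)
    <= avg f x - avg f xs - dot (grad (avg f) xs) (x - xs).
  rewrite dot_grad_avg// /avg -!mulrBr ler_wpM2l ?invr_ge0//.
  by rewrite -!sumrB; apply: ler_sum => j _; exact: cocoercive.
rewrite -mulr_sumr exchange_big/= in coco.
rewrite dotBr (dotC (x - xs) (grad _ x)) (dotC (x - xs) (grad _ xs)).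
have xxs : dot (grad (avg f) x) (xs - x) = - dot (grad (avg f) x) (x - xs).
  by rewrite -dotNr opprB.
rewrite xxs in qsc.
by move: qsc coco; lra.
Qed.

End Descent.

(** * Contraction of the Lyapunov function in one iteration *)

Section Step.
Context {R : realType} {d n : nat} (f : 'I_n -> 'rV[R]_d -> R).
Context (psi : 'rV[R]_d -> \bar R) (alpha sigma : R).
Context (p : 'rV[R]_d) (r q : 'rV[R]_n) (PP : 'M[R]_n).

(** One iteration as a deterministic function of state and draw, the form in which
    [expectation_drift] takes it. *)
Definition saega_step (xJ : 'rV[R]_d * 'M[R]_(d, n))
    (a : {set 'I_d} * {set 'I_n}) : 'rV[R]_d * 'M[R]_(d, n) :=
  let J' := saega_jac f xJ.1 xJ.2 a.1 a.2 in
  (prox alpha psi (xJ.1 - alpha *: saega_est p r xJ.2 J'), J').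

Lemma saegaS x0 Lk Rk k : saega f psi alpha p r x0 Lk Rk k.+1 =
  saega_step (saega f psi alpha p r x0 Lk Rk k) (Lk k, Rk k).
Proof. by rewrite /=; case: (saega _ _ _ _ _ _ _ _ k). Qed.

(* With these weights the gradient entries of [x] injected into the stored table
   cost half of what co-coercivity yields: [w p r = 1 / (2 n m)]. *)
Definition lyapunov_weight : 'M[R]_(d, n) :=
  \matrix_(i, j) Num.sqrt (2 * n%:R * p 0 i * r 0 j)^-1.

Context (m : 'I_n -> 'rV[R]_d) (xs : 'rV[R]_d).
Context (mu : {set 'I_d} * {set 'I_n} -> R) (law : block_law mu p r q PP).

Let N : R := n%:R.

(** On a sampled entry the table changes by the error of the new gradient entry minus that of the
    stored one; elsewhere it does not change. *)
Lemma saega_est_block x J a i :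
  saega_est p r J (saega_jac f x J a.1 a.2) 0 i
    - N^-1 * (\sum_j partial (f j) i xs) =
  block_avg p r i (fun j => partial (f j) i x - partial (f j) i xs) a
  + (N^-1 * (\sum_j (J i j - partial (f j) i xs))
     - block_avg p r i (fun j => J i j - partial (f j) i xs) a).
Proof.
rewrite mxE /block_avg -!mulrBr -mulrDr -/N; congr (_ * _).
rewrite -!sumrB -big_split/=; apply: eq_bigr => j _.
by rewrite mxE /block; case: (_ && _) => /=; ring.
Qed.

Context (n_gt0 : (0 < n)%N).
Context (q_gt0 : forall j, 0 < q 0 j) (m_gt0 : forall j i, 0 < m j 0 i).
Context (alpha_gt0 : 0 < alpha) (sigma_gt0 : 0 < sigma).
Context (alpha_le :
  forall i j, alpha * (4 * m j 0 i + N * sigma) <= N * p 0 i * q 0 j).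

Let N_gt0 : 0 < N. Proof. by rewrite ltr0n. Qed.

Lemma lyapunov_weight_gt0 i j : 0 < lyapunov_weight i j.
Proof.
by rewrite mxE sqrtr_gt0 invr_gt0 !mulr_gt0// ?(law_p_gt0 law)// (law_r_gt0 law).
Qed.

Lemma lyapunov_weight_sqr i j :
  lyapunov_weight i j ^+ 2 = (2 * N * p 0 i * r 0 j)^-1.
Proof.
rewrite mxE sqr_sqrtr// invr_ge0 !mulr_ge0// ltW//.
  exact: (law_p_gt0 law).
exact: (law_r_gt0 law).
Qed.

(* [x] and [y] stand for the squared errors of a gradient entry and of its
   stored value. *)
Lemma entry_contraction i j (x y : R) : 0 <= x -> 0 <= y ->
  alpha * (2 * (N^-1 ^+ 2 * (p 0 i)^-1 * (x / q 0 j + y / q 0 j)))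
  + lyapunov_weight i j ^+ 2 / m j 0 i
    * ((1 - p 0 i * r 0 j) * y + p 0 i * r 0 j * x)
  <= N^-1 * (x / m j 0 i)
     + (1 - alpha * sigma) * (lyapunov_weight i j ^+ 2 / m j 0 i * y).
Proof.
move=> x0 y0; rewrite lyapunov_weight_sqr.
have p0 := law_p_gt0 law i; have r0 := law_r_gt0 law j.
have qr : q 0 j <= r 0 j by exact: (eso_le_prob law i).
have := alpha_le i j; have := q_gt0 j; have := m_gt0 j i.
move: (p 0 i) (r 0 j) (q 0 j) (m j 0 i) p0 r0 qr => pi rj qj mij.
move=> p0 r0 qr m0 q0 al.
(* The stepsize bound is exactly [t + s <= 1]: [t] pays for the estimator's second moment, [s] for
   the contraction. *)
pose t := alpha * (4 * mij) / (N * pi * qj).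
pose s := alpha * sigma / (pi * qj).
have ts : t + s <= 1.
  have -> : t + s = alpha * (4 * mij + N * sigma) / (N * pi * qj).
    by rewrite /t /s; field; rewrite !gt_eqF.
  by rewrite ler_pdivrMr ?mul1r// !mulr_gt0.
have s0 : 0 <= s by rewrite divr_ge0 ?mulr_ge0// ltW.
have t0 : 0 <= t by rewrite divr_ge0 ?mulr_ge0// ltW.
have sr : alpha * sigma / (pi * rj) <= s.
  rewrite ler_pM2l ?mulr_gt0// lef_pV2 ?posrE ?mulr_gt0//.
  by rewrite ler_pM2l.
(* The claim multiplied by [2 N m]. The coefficient of [x] needs [t <= 1]; that of [y] needs
   [t + alpha sigma / (p r) <= 1], which follows from [q <= r] through [sr]. *)
have key : (t + 1) * x + (t + (pi * rj)^-1 - 1) * y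
    <= 2 * x + ((pi * rj)^-1 - alpha * sigma / (pi * rj)) * y.
  by rewrite lerD// ler_wpM2r//; lra.
have c0 : 0 < (2 * N * mij)^-1 by rewrite invr_gt0 !mulr_gt0.
rewrite -(ler_pM2l c0) in key; apply: le_trans (le_trans key _).
  rewrite /t le_eqVlt; apply/orP; left; apply/eqP; field.
  by rewrite !gt_eqF.
rewrite le_eqVlt; apply/orP; left; apply/eqP; field.
by rewrite !gt_eqF.
Qed.

Context (f_diff : forall j x, differentiable (f j) x).
Context (f_convex : forall j, convex_function [set: 'rV[R]_d] (f j)).
Context (f_smooth : forall j, diag_smooth (m j) (f j)).
Context (f_qsc : quasi_strongly_convex sigma (avg f) xs).
Context (psi_proper : proper_efun psi) (psi_closed : closed_efun psi)
  (psi_convex : convex_efun psi).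
Context (xs_min : unique_minimizer (fun x => ((avg f x)%:E + psi x)%E) xs).

Lemma avg_smooth_line y h (t : R) :
  avg f (y + t *: h) <= avg f y + t * dot (grad (avg f) y) h
    + t ^+ 2 * (N^-1 * \sum_j quad (m j) h).
Proof.
rewrite dot_grad_avg// /avg -/N !(mulrCA _ N^-1) -!mulrDr ler_pM2l ?invr_gt0//.
rewrite !mulr_sumr -!big_split/=; apply: ler_sum => j _.
exact: diag_smooth_line.
Qed.

(** First-order optimality of [xs]: minus the gradient of [f] at [xs] is a subgradient of [psi]
    there. *)
Lemma minimizer_subgradient : exists b, psi xs = b%:E /\
  forall v, ((b - dot (grad (avg f) xs) (v - xs))%:E <= psi v)%E.
Proof.
have xs_argmin : argmin (fun x => ((avg f x)%:E + psi x)%E) xs.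
  by rewrite xs_min.
have [psiNy [v0 psi0]] := psi_proper.
have [b pb] : exists b, psi xs = b%:E.
  have := xs_argmin v0; move: psi0 (psiNy v0) (psiNy xs).
  case: (psi xs) => [b _ _ _ _||]; [by exists b| |by []].
  by case: (psi v0) => // c _ _ _; rewrite addey// leye_eq -EFinD.
exists b; split=> // v.
case psiv: (psi v) => [c||]; [|by rewrite leey|by have := psiNy v; rewrite psiv].
rewrite lee_fin.
have := @argmin_variational _ _ psi (avg f) 1
  (dot (grad (avg f) xs) (v - xs)) _ _ _ xs v
  psi_convex ltr01 _ (fun t _ => avg_smooth_line xs (v - xs) t) pb psiv.
rewrite !mul1r => /(_ _)/wrap[]; last by lra.
by move=> y; have := xs_argmin y; rewrite !mul1e ![(_ + psi _)%E]addeC.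
Qed.

Lemma saega_step_descent xJ :
  mean mu (fun a => lyapunov f m xs alpha lyapunov_weight (saega_step xJ a))
    <= (1 - alpha * sigma) * lyapunov f m xs alpha lyapunov_weight xJ.
Proof.
case: xJ => x J; rewrite {2}/lyapunov/=.
have [b [pb sub]] := minimizer_subgradient.
set gs := grad (avg f) xs in sub.
pose u i j := partial (f j) i x - partial (f j) i xs.
pose v i j := J i j - partial (f j) i xs.
pose e i a := block_avg p r i (u i) a
  + (N^-1 * (\sum_j v i j) - block_avg p r i (v i) a).
pose w i j := lyapunov_weight i j ^+ 2 / m j 0 i.
have estE a : saega_est p r J (saega_jac f x J a.1 a.2) - gs = \row_i e i a.
  apply/rowP => i; rewrite [LHS]mxE [X in _ + X]mxE [RHS]mxE [gs 0 i]mxE.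
  by rewrite partial_avg// saega_est_block.
have gradE : grad (avg f) x - gs = \row_i (N^-1 * \sum_j u i j).
  by apply/rowP => i; rewrite !mxE !partial_avg// -mulrBr -sumrB.
(* For each draw, prox contraction leaves the squared norm of [x - xs - alpha (g - gs)], expanded by
   coordinates so that means can be taken one coordinate at a time. *)
have bound a : lyapunov f m xs alpha lyapunov_weight (saega_step (x, J) a)
    <= sqnorm (x - xs)
       + (\sum_i (- (2 * alpha * (x - xs) 0 i) * e i a + alpha ^+ 2 * e i a ^+ 2)
       + alpha * \sum_i \sum_j w i j * (if (i \in a.1) && (j \in a.2)
                                      then u i j else v i j) ^+ 2).
  rewrite /lyapunov/= addrA; apply: lerD; last first.
    rewrite ler_pM2l//; apply: ler_sum => i _; apply: ler_sum => j _.
    by rewrite [saega_jac _ _ _ _ _ i j]mxE; case: (_ && _).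
  apply: le_trans
    (prox_contraction _ alpha_gt0 psi_proper psi_closed psi_convex pb sub) _.
  set g := saega_est _ _ _ _.
  have -> : x - alpha *: g + alpha *: gs - xs = (x - xs) - alpha *: (g - gs).
    by apply/rowP => i; rewrite !mxE; ring.
  rewrite (sqnormB (x - xs)) -(addrA (sqnorm (x - xs))) lerD2l dotZr sqnormZ estE.
  rewrite big_split/= -mulr_sumr.
  rewrite le_eqVlt; apply/orP; left; apply/eqP; congr (_ + _ * _).
    rewrite /dot !mulr_sumr -sumrN.
    by apply: eq_bigr => i _; rewrite !mxE; ring.
  by apply: eq_bigr => i _; rewrite !mxE expr2.
apply: le_trans (ler_mean (law_ge0 law) bound) _.
rewrite !meanD mean_cst ?(law_sum1 law)// meanZ !mean_sum.
have est_mean i : mean mu (fun a => - (2 * alpha * (x - xs) 0 i) * e i a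
      + alpha ^+ 2 * e i a ^+ 2)
    <= - (2 * alpha) * ((x - xs) 0 i * (N^-1 * \sum_j u i j))
       + alpha * (alpha * \sum_j
         2 * (N^-1 ^+ 2 * (p 0 i)^-1 * (u i j ^+ 2 / q 0 j + v i j ^+ 2 / q 0 j))).
  have e1 : mean mu (e i) = N^-1 * \sum_j u i j.
    pose c := N^-1 * \sum_j v i j.
    rewrite (eq_mean _ (Y := fun a => block_avg p r i (u i) a
      + (c + -1 * block_avg p r i (v i) a))); last by move=> a; rewrite mulN1r.
    rewrite !meanD (meanZ _ (-1)) mean_cst ?(law_sum1 law)//.
    have M w' : mean mu (fun a => block_avg p r i w' a) = N^-1 * \sum_j w' j.
      exact: mean_block_avg law _ _.
    by rewrite !M; rewrite /c; ring.
  have e2 := mean_block_avg_mix law i (u i) (v i).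
  rewrite meanD (meanZ _ (- _)) (meanZ _ (alpha ^+ 2)).
  have -> : mean mu (fun a => e i a) = N^-1 * \sum_j u i j by [].
  rewrite -!mulr_sumr; set S := \sum_j (_ + _) in e2 *.
  have := ler_wpM2l (sqr_ge0 alpha) e2; rewrite -/N /e; lra.
have jac_mean i : mean mu (fun a => \sum_j w i j *
      (if (i \in a.1) && (j \in a.2) then u i j else v i j) ^+ 2)
    = \sum_j w i j
        * ((1 - p 0 i * r 0 j) * v i j ^+ 2 + p 0 i * r 0 j * u i j ^+ 2).
  rewrite mean_sum; apply: eq_bigr => j _.
  by rewrite (meanZ _ (w i j)) (mean_block_update law).
under [X in _ + (_ + _ * X)]eq_bigr do rewrite jac_mean.
have desc := descent_ineq x f_diff f_convex f_smooth m_gt0 f_qsc.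
rewrite -/gs gradE in desc.
have dotE : dot (x - xs) (\row_i (N^-1 * \sum_j u i j))
    = \sum_i (x - xs) 0 i * (N^-1 * \sum_j u i j).
  by apply: eq_bigr => i _; rewrite [X in _ * X]mxE.
rewrite dotE in desc.
have est := ler_sum (index_enum 'I_d) (fun i (_ : true) => est_mean i).
rewrite big_split/= -!mulr_sumr in est.
have ent : alpha * (\sum_i \sum_j 2 * (N^-1 ^+ 2 * (p 0 i)^-1 *
        (u i j ^+ 2 / q 0 j + v i j ^+ 2 / q 0 j)))
      + \sum_i \sum_j w i j * ((1 - p 0 i * r 0 j) * v i j ^+ 2
                              + p 0 i * r 0 j * u i j ^+ 2)
   <= N^-1 * (\sum_i \sum_j u i j ^+ 2 / m j 0 i)
      + (1 - alpha * sigma) * \sum_i \sum_j w i j * v i j ^+ 2.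
  rewrite !mulr_sumr -!big_split/=; apply: ler_sum => i _.
  rewrite !mulr_sumr -!big_split/=; apply: ler_sum => j _.
  by apply: entry_contraction; rewrite sqr_ge0.
(* Once scaled by [alpha], [desc] bounds the cross term of [est], and its sum [U] cancels against
   the one in [ent]; what remains is linear. *)
rewrite -(ler_pM2l alpha_gt0) in ent; rewrite -(ler_pM2l alpha_gt0) in desc.
move: est ent desc; rewrite -/N.
set E := \sum_i mean _ _.
set Q := \sum_i \sum_j 2 * _.
set D := \sum_i _ * _.
set J' := \sum_i \sum_j w i j * (_ + _).
set U := \sum_i \sum_j _ / _.
set W := \sum_i \sum_j w i j * _.
set S := sqnorm _.
move=> est ent desc.
lra.
Qed.

End Step.

(** * Expectations of finitely valued random elements *)

Section FiniteRandomElements.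
Context {disp : measure_display} {T : measurableType disp} {R : realType}.
Variable P : probability T R.

Definition point_law {F : finType} (X : T -> F) (a : F) : R :=
  fine (P (X @^-1` [set a])).

Lemma point_law_ge0 {F : finType} (X : T -> F) a : 0 <= point_law X a.
Proof. by rewrite fine_ge0. Qed.

(** Writes [phi (X w)] as a sum of [phi a] times the indicator of [X = a] and integrates
    termwise. *)
Lemma expectation_finite {F : finType} (X : T -> F) (phi : F -> R) :
  (forall a, measurable (X @^-1` [set a])) -> (forall a, 0 <= phi a) ->
  'E_P[fun w => phi (X w)]%E = (mean (point_law X) phi)%:E.
Proof.
move=> mX phi0; rewrite unlock.
under eq_integral => w _.
  have -> : (phi (X w))%:E = (\sum_a (phi a * \1_(X @^-1` [set a]) w)%:E)%E.
    rewrite sumEFin (bigD1 (X w))//= big1 ?addr0 => [|a /eqP aX].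
      by rewrite indicE mem_set// mulr1.
    by rewrite indicE memNset ?mulr0//= => /esym.
  over.
rewrite ge0_integral_sum//; last 2 first.
- by move=> a; apply/measurable_EFinP; apply: measurable_funM.
- by move=> a w _; rewrite lee_fin mulr_ge0.
rewrite -sumEFin; apply: eq_bigr => a _.
under eq_integral do rewrite EFinM.
rewrite ge0_integralZl//; last 2 first.
- by apply/measurable_EFinP; exact: measurable_indic.
- by rewrite lee_fin.
rewrite integral_indic// setIT mulrC EFinM fineK//.
exact: fin_num_measure.
Qed.

Lemma mean_point_law_indic {F : finType} (X : T -> F) (B : pred F) :
  (forall A : set F, measurable (X @^-1` A)) ->
  mean (point_law X) (fun a => (B a)%:R) = fine (P [set w | B (X w)]).
Proof.
move=> mX.
have mB : measurable [set w | B (X w)] := mX [set a | B a].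
have := expectation_finite (phi := fun a => (B a)%:R) (fun a => mX [set a]).
rewrite (_ : (fun w => _) = \1_[set w | B (X w)]).
  by rewrite expectation_indic// => -> // a; rewrite ler0n.
apply/funext => w; rewrite indicE.
by case BX: (B (X w)); [rewrite mem_set|rewrite memNset//= BX].
Qed.

(** * Independent draws and the drift argument *)

Section History.
Context {F : finType} (a0 : F) (X : nat -> T -> F).
Context (mX : forall k (A : set F), measurable (X k @^-1` A)).
Context (indX : mutually_independent P X).

(** The past as an element of a finite type, which reduces conditioning on it to finite sums. *)
Definition history k w : k.-tuple F := [tuple of mkseq (X^~ w) k].

(** [B] is prescribed below [k] only, so that one family can also describe the next draw. *)
Lemma history_preimage k (h : k.-tuple F) (B : nat -> set F) :
  (forall l, (l < k)%N -> B l = [set nth a0 h l]) ->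
  history k @^-1` [set h] = \big[setI/setT]_(l <- iota 0 k) (X l @^-1` B l).
Proof.
move=> Bh; rewrite -bigcap_seq; apply/seteqP; split => w /=.
  move=> hE l /=; rewrite mem_iota add0n => /= lk.
  by rewrite Bh//= -hE nth_mkseq.
move=> Xh; apply: val_inj => /=; apply: (@eq_from_nth _ a0).
  by rewrite size_mkseq size_tuple.
rewrite size_mkseq => l lk; rewrite nth_mkseq//.
by have := Xh l; rewrite /= mem_iota add0n lk Bh//; apply.
Qed.

Lemma measurable_history k h : measurable (history k @^-1` [set h]).
Proof.
rewrite (history_preimage (B := fun l => [set nth a0 h l]))//.
exact: bigsetI_measurable.
Qed.

(** Mutual independence is applied to the indices below [k], with and without [k] itself. *)
Lemma point_law_history k h a :
  point_law (fun w => (history k w, X k w)) (h, a)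
    = point_law (history k) h * point_law (X k) a.
Proof.
pose B l := if (l < k)%N then [set nth a0 h l] else [set a].
have Bh l : (l < k)%N -> B l = [set nth a0 h l] by rewrite /B => ->.
rewrite /point_law (history_preimage Bh).
have -> : (fun w => (history k w, X k w)) @^-1` [set (h, a)]
    = \big[setI/setT]_(l <- k :: iota 0 k) (X l @^-1` B l).
  rewrite big_cons -(history_preimage Bh) {1}/B ltnn.
  by apply/seteqP; split => w /= [-> ->].
rewrite !indX ?iota_uniq//= ?mem_iota ?add0n ?ltnn ?iota_uniq//.
rewrite big_cons {1}/B ltnn muleC fineM//; last exact: fin_num_measure.
by rewrite -indX ?iota_uniq//; apply: fin_num_measure; exact: bigsetI_measurable.
Qed.

(** The state is a fold of [step] over the history, and the next draw is independent of that
    history. Summing over the draw first, with the history fixed, lets the one-step bound apply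
    inside the induction. *)
Lemma expectation_drift (S : Type) (step : S -> F -> S) (state : nat -> T -> S)
    (s0 : S) (V : S -> R) (c : R) :
  (forall w, state 0 w = s0) ->
  (forall k w, state k.+1 w = step (state k w) (X k w)) ->
  (forall s, 0 <= V s) -> 0 <= c ->
  (forall k s, mean (point_law (X k)) (fun a => V (step s a)) <= c * V s) ->
  forall k, ('E_P[fun w => V (state k w)] <= (c ^+ k * V s0)%:E)%E.
Proof.
move=> st0 stS V0 c0 drift.
have stE k w : state k w = foldl step s0 (history k w).
  elim: k => [|k IH]; first by rewrite st0.
  by rewrite stS IH -foldl_rcons; congr foldl; rewrite [RHS]mkseqS.
elim=> [|k IH].
  under [X in expectation _ X]eq_fun do rewrite st0.
  by rewrite expectation_cst expr0 mul1r.
have EV : 'E_P[fun w => V (state k w)]%E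
    = (mean (point_law (history k)) (fun h => V (foldl step s0 h)))%:E.
  rewrite -expectation_finite//; last exact: measurable_history.
  by congr expectation; apply/funext => w; rewrite stE.
have -> : 'E_P[fun w => V (state k.+1 w)]%E
    = (mean (point_law (fun w => (history k w, X k w)))
         (fun ha => V (step (foldl step s0 ha.1) ha.2)))%:E.
  rewrite -expectation_finite//.
    by congr expectation; apply/funext => w; rewrite stS stE.
  move=> [h a].
  rewrite (_ : _ @^-1` _ = history k @^-1` [set h] `&` X k @^-1` [set a]).
    by apply: measurableI => //; exact: measurable_history.
  by apply/seteqP; split => w /= [-> ->].
rewrite EV lee_fin in IH; rewrite lee_fin exprS -mulrA.
apply: le_trans (ler_wpM2l c0 IH).
set Z := fun w => (history k w, X k w).
rewrite /mean (eq_bigr (fun ha => point_law Z (ha.1, ha.2)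
  * V (step (foldl step s0 ha.1) ha.2))) => [|[]//].
rewrite -(pair_bigA _ (fun (h : k.-tuple F) a =>
  point_law Z (h, a) * V (step (foldl step s0 h) a)))/=.
rewrite mulr_sumr.
apply: ler_sum => h _.
under eq_bigr do rewrite point_law_history -mulrA.
by rewrite -mulr_sumr mulrCA ler_wpM2l ?point_law_ge0//; exact: drift.
Qed.

End History.

End FiniteRandomElements.

(** * From the matrix inequality and the samplings to [block_law] *)

Lemma invmx_diag {F : fieldType} {n : nat} (v : 'rV[F]_n) :
  (forall j, v 0 j != 0) -> invmx (diag_mx v) = diag_mx (\row_j (v 0 j)^-1).
Proof.
move=> v0; set w := \row_j _.
have vw : diag_mx v *m diag_mx w = 1%:M.
  rewrite mulmx_diag -diag_const_mx; congr diag_mx.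
  by apply/rowP => j; rewrite !mxE mulfV.
by have [uv _] := mulmx1_unit vw; rewrite -[RHS](mulKmx uv) vw mulmx1.
Qed.

(** The Loewner inequality tested on the column [v], both quadratic forms written out entrywise. *)
Lemma eso_of_loewner {R : realType} {n : nat} (r q : 'rV[R]_n) (A : 'M[R]_n)
    (v : 'I_n -> R) : (forall j, 0 < r 0 j) -> (forall j, 0 < q 0 j) ->
  loewner_le (invmx (diag_mx r) *m A *m invmx (diag_mx r)) (invmx (diag_mx q)) ->
  \sum_j \sum_j' v j * v j' * A j j' / (r 0 j * r 0 j')
    <= \sum_j v j ^+ 2 / q 0 j.
Proof.
move=> r0 q0; rewrite !invmx_diag; [|by move=> j; rewrite gt_eqF..].
move=> /(_ (\col_j v j)).
rewrite mulmxBr mulmxBl mxE [X in _ + X]mxE subr_ge0.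
congr (_ <= _).
  rewrite mxE exchange_big; apply: eq_bigr => j' _.
  rewrite mxE mulr_suml; apply: eq_bigr => j _.
  by rewrite mul_diag_mx mul_mx_diag !mxE; field; rewrite !gt_eqF.
rewrite mxE; apply: eq_bigr => j _.
by rewrite mul_mx_diag !mxE; ring.
Qed.

Lemma random_element_pair {disp : measure_display} {T : measurableType disp}
    {F G : finType} (X : T -> F) (Y : T -> G) :
  random_element X -> random_element Y -> random_element (fun w => (X w, Y w)).
Proof.
move=> mX mY A.
rewrite (_ : _ @^-1` _ =
    \bigcup_(a in A) (X @^-1` [set a.1] `&` Y @^-1` [set a.2])).
  apply: fin_bigcup_measurable => [|a _]; first exact: finite_finset.
  exact: measurableI.
apply/seteqP; split => [w Aw|w [[a b] Aab [/= -> ->]]//].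
by exists (X w, Y w).
Qed.

Lemma incl_prob_le1 {R : realType} {d : nat} {disp : measure_display}
    {T : measurableType disp} (P : probability T R) (S : T -> {set 'I_d}) i :
  random_element S -> incl_prob P S 0 i <= 1.
Proof.
move=> mS; have mA := mS [set A : {set 'I_d} | i \in A].
by rewrite mxE -lee_fin fineK ?fin_num_measure// probability_le1.
Qed.

(** [LS'] and [RS'] are the draws of one iteration, [LS] and [RS] the samplings defining [p], [r]
    and the inclusion matrix. Independence factors each moment, and equality in law moves the
    factors to the samplings. *)
Lemma block_law_sampling {R : realType} {d n : nat} {disp : measure_display}
    {T : measurableType disp} (P : probability T R)
    (LS LS' : T -> {set 'I_d}) (RS RS' : T -> {set 'I_n}) (q : 'rV[R]_n) :
  let p := incl_prob P LS in let r := incl_prob P RS in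
  random_element LS' -> random_element RS' ->
  same_law P LS' LS -> same_law P RS' RS -> independent P LS' RS' ->
  (forall i, 0 < p 0 i) -> (forall j, 0 < r 0 j) -> (forall j, 0 < q 0 j) ->
  loewner_le (invmx (diag_mx r) *m incl_mx P RS *m invmx (diag_mx r))
             (invmx (diag_mx q)) ->
  block_law (point_law P (fun w => (LS' w, RS' w))) p r q (incl_mx P RS).
Proof.
move=> p r mL mR lL lR ind p0 r0 q0 eso.
have mZ := random_element_pair mL mR.
have pair (A : set {set 'I_d}) (B : set {set 'I_n}) :
    fine (P (LS' @^-1` A `&` RS' @^-1` B))
    = fine (P (LS @^-1` A)) * fine (P (RS @^-1` B)).
  rewrite ind lL lR fineM//.
    by rewrite -lL; exact: fin_num_measure.
  by rewrite -lR; exact: fin_num_measure.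
split => //.
- by move=> a; exact: point_law_ge0.
- have := mean_point_law_indic P predT mZ => /= ->.
  by rewrite (_ : [set w | _] = setT) ?probability_setT//; apply/seteqP; split.
- move=> i j.
  have := mean_point_law_indic P
    (fun a : {set 'I_d} * {set 'I_n} => (i \in a.1) && (j \in a.2)) mZ => /= ->.
  rewrite !mxE.
  rewrite -(pair [set A : {set 'I_d} | i \in A] [set B : {set 'I_n} | j \in B]).
  by congr (fine (P _)); apply/seteqP; split => w /= /andP.
- move=> i j j'.
  rewrite (eq_mean _ (Y := fun a : {set 'I_d} * {set 'I_n} =>
      ([&& i \in a.1, j \in a.2 & j' \in a.2])%:R)).
    have := mean_point_law_indic P
      (fun a : {set 'I_d} * {set 'I_n} =>
         [&& i \in a.1, j \in a.2 & j' \in a.2]) mZ => /= ->.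
    rewrite !mxE -(pair [set A : {set 'I_d} | i \in A]
      [set B : {set 'I_n} | j \in B /\ j' \in B]).
    congr (fine (P _)); apply/seteqP; split => w /=.
      by move=> /and3P[].
    by move=> [? [? ?]]; apply/and3P.
  move=> a; rewrite /block.
  by case: (i \in a.1) (j \in a.2) (j' \in a.2) => [] [] [] /=; ring.
- by move=> v; exact: eso_of_loewner.
Qed.

(** * Stepsize, rate and the iteration complexity *)

Lemma min_ijP {R : realType} {d n : nat} (F : 'I_d.+1 -> 'I_n.+1 -> R) :
  (exists i j, min_ij F = F i j) /\ (forall i j, min_ij F <= F i j).
Proof.
split=> [|i j]; last exact: (bigmin_le _ (i, j)).
rewrite /min_ij; elim/big_ind: _ => [|x y [i [j ->]] [i' [j' ->]]|[i j] _].
- by exists ord0, ord0.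
- by rewrite /Num.min; case: ifP => _; [exists i, j|exists i', j'].
- by exists i, j.
Qed.

Lemma le_max_ij {R : realType} {d n : nat} (F : 'I_d.+1 -> 'I_n.+1 -> R) i j :
  F i j <= max_ij F.
Proof. exact: (le_bigmax _ _ (i, j)). Qed.

(** By [1 - a <= exp (- a)] the power is at most [exp (- a k)], and [a k >= ln (1 / eps)]. *)
Lemma geometric_le (R : realType) (a eps rate : R) (k : nat) :
  0 < a <= 1 -> 0 < eps < 1 -> a^-1 <= rate -> rate * ln (eps^-1) <= k%:R ->
  (1 - a) ^+ k <= eps.
Proof.
move=> /andP[a0 a1] /andP[e0 e1] arate ratek.
have ln0 : 0 < ln eps^-1 by rewrite ln_gt0// invf_gt1.
have kle : ln eps^-1 <= a * k%:R.
  rewrite mulrC -ler_pdivrMr// mulrC; apply: le_trans ratek.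
  by rewrite ler_pM2r.
apply: (@le_trans _ _ (expR (- a) ^+ k)).
  rewrite lerXn2r ?nnegrE ?expR_ge0 ?subr_ge0//.
  exact: expR_ge1Dx.
rewrite -expRM_natl -[leRHS](lnK e0) ler_expR.
by rewrite lnV ?posrE// in kle; lra.
Qed.

Theorem corollaryM1 (R : realType) (d n : nat)
    (f : 'I_n.+1 -> 'rV[R]_d.+1 -> R) (psi : 'rV[R]_d.+1 -> \bar R)
    (xs : 'rV[R]_d.+1) (sigma : R) (m : 'I_n.+1 -> 'rV[R]_d.+1)
    (f_diff : forall j x, differentiable (f j) x)
    (f_convex : forall j, convex_function [set: 'rV[R]_d.+1] (f j))
    (psi_proper : proper_efun psi) (psi_closed : closed_efun psi)
    (psi_convex : convex_efun psi)
    (xs_min : unique_minimizer (fun x => ((avg f x)%:E + psi x)%E) xs)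
    (sigma_gt0 : 0 < sigma)
    (f_qsc : quasi_strongly_convex sigma (avg f) xs)
    (m_gt0 : forall j i, 0 < m j 0 i)
    (f_smooth : forall j, diag_smooth (m j) (f j))
    (disp : measure_display) (T : measurableType disp) (P : probability T R)
    (LS : T -> {set 'I_d.+1}) (RS : T -> {set 'I_n.+1})
    (LS_rand : random_element LS) (RS_rand : random_element RS)
    (LRS_indep : independent P LS RS)
    (Lk : nat -> T -> {set 'I_d.+1}) (Rk : nat -> T -> {set 'I_n.+1})
    (Lk_rand : forall k, random_element (Lk k))
    (Rk_rand : forall k, random_element (Rk k))
    (Lk_law : forall k, same_law P (Lk k) LS)
    (Rk_law : forall k, same_law P (Rk k) RS)
    (LRk_indep : forall k, independent P (Lk k) (Rk k))
    (draws_indep : mutually_independent P (fun k w => (Lk k w, Rk k w)))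
    (x0 : 'rV[R]_d.+1) (q : 'rV[R]_n.+1) (q_gt0 : forall j, 0 < q 0 j) :
  let N : R := n.+1%:R in
  let p := incl_prob P LS in
  let r := incl_prob P RS in
  (forall i, 0 < p 0 i) -> (forall j, 0 < r 0 j) ->
  loewner_le (invmx (diag_mx r) *m incl_mx P RS *m invmx (diag_mx r))
             (invmx (diag_mx q)) ->
  let alpha :=
    min_ij (fun i j => N * p 0 i * q 0 j / (4 * m j 0 i + N * sigma)) in
  let rate :=
    max_ij (fun i j => 4 * (m j 0 i / (sigma * N * p 0 i * q 0 j))
                       + (p 0 i * q 0 j)^-1) in
  exists B : 'M[R]_(d.+1, n.+1),
    (forall i j, 0 < B i j) /\
    let state k w :=
      saega f psi alpha p r x0 (fun l => Lk l w) (fun l => Rk l w) k in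
    let Psi k w := lyapunov f m xs alpha B (state k w) in
    forall eps : R, 0 < eps < 1 -> forall k : nat,
      rate * ln (eps^-1) <= k%:R ->
      ('E_P[Psi k] <= (eps * lyapunov f m xs alpha B (x0, 0%R))%:E)%E.
Proof.
move=> N p r p0 r0 eso alpha rate.
have laws k : block_law (point_law P (fun w => (Lk k w, Rk k w))) p r q
    (incl_mx P RS) by exact: block_law_sampling.
have N0 : 0 < N by rewrite ltr0n.
have [[i0 [j0 alphaE]] alpha_min] := min_ijP
  (fun i j => N * p 0 i * q 0 j / (4 * m j 0 i + N * sigma)).
rewrite -/alpha in alphaE alpha_min.
have den0 i j : 0 < 4 * m j 0 i + N * sigma by rewrite addr_gt0 ?mulr_gt0.
have alpha0 : 0 < alpha by rewrite alphaE divr_gt0 ?mulr_gt0.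
have alpha_le i j : alpha * (4 * m j 0 i + N * sigma) <= N * p 0 i * q 0 j.
  by rewrite -ler_pdivlMr.
(* At the pair where the stepsize minimum is attained, [1 / (alpha sigma)] equals the corresponding
   entry of the maximum. *)
have rateE : (alpha * sigma)^-1 <= rate.
  apply: le_trans (le_max_ij _ i0 j0); rewrite alphaE le_eqVlt.
  have NE : 1 + n%:R = N by rewrite addrC natr1.
  by apply/orP; left; apply/eqP; field; rewrite NE !gt_eqF.
(* From [alpha N sigma <= N p q] and [q <= r <= 1]; it makes the factor [1 - alpha sigma]
   nonnegative. *)
have as1 : alpha * sigma <= 1.
  have p1 : p 0 i0 <= 1 by exact: incl_prob_le1.
  have r1 : r 0 j0 <= 1 by exact: incl_prob_le1.
  have qr : q 0 j0 <= r 0 j0 by exact: (eso_le_prob (laws 0) i0).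
  have pq1 : p 0 i0 * q 0 j0 <= 1.
    by apply: mulr_ile1; rewrite ?(le_trans qr)// ltW.
  rewrite -(ler_pM2l N0) mulr1.
  have := alpha_le i0 j0; have := mulr_gt0 alpha0 (m_gt0 j0 i0).
  by rewrite -(ler_pM2l N0) in pq1; lra.
exists (lyapunov_weight p r); split.
  by move=> i j; exact: (lyapunov_weight_gt0 (laws 0)).
move=> state Psi eps eps01 k ratek.
have V0 xJ : 0 <= lyapunov f m xs alpha (lyapunov_weight p r) xJ.
  rewrite addr_ge0 ?sqnorm_ge0// mulr_ge0 ?(ltW alpha0)//.
  apply: sumr_ge0 => i _; apply: sumr_ge0 => j _.
  by rewrite mulr_ge0 ?sqr_ge0// divr_ge0 ?sqr_ge0// ltW.
(* The pair of empty sets is the default value of [nth] in the encoding of histories. *)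
have drift := @expectation_drift _ _ _ P _ (finset.set0, finset.set0)
  (fun k w => (Lk k w, Rk k w))
  (fun k => random_element_pair (Lk_rand k) (Rk_rand k)) draws_indep _
  (saega_step f psi alpha p r) state (x0, 0)
  (lyapunov f m xs alpha (lyapunov_weight p r)) (1 - alpha * sigma).
apply: le_trans (drift _ _ V0 _ _ k) _ => //.
- by move=> k' w; exact: saegaS.
- by rewrite subr_ge0.
- by move=> k' s; exact: (saega_step_descent (laws k')).
rewrite lee_fin ler_wpM2r//.
by apply: geometric_le eps01 rateE ratek; rewrite mulr_gt0.
Qed.
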